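(* For every Esakia space $X$, the category $\mathbf{EsaEt}(X)$ is finitely propositional.
   Context: A category with a terminal object is finitely propositional if for every object $Y$ there is a finite jointly epimorphic family $\{V_i\to Y\}_{i\in I}$ with each $V_i$ subterminal (i.e. the unique morphism $V_i\to 1$ is a monomorphism). Priestley and Esakia spaces. An upset of a poset is an upward-closed subset; ${\downarrow}S$ denotes the downward closure of $S$. An ordered space is a poset equipped with a topology. A Priestley space is a compact ordered space $X$ such that whenever $x\nleq y$ there is a clopen upset $U$ with $x\in U$, $y\notin U$. An Esakia space is a Priestley space in which ${\downarrow}W$ is clopen for every clopen $W$. Spectral local homeomorphisms. The spectral topology on a Priestley space is the topology consisting of all open upsets. A spectral local homeomorphism $f\colon Y\to X$ between Priestley spaces is a function that is a local homeomorphism with respect to the spectral topologies. The category $\mathbf{EsaEt}(X)$. For an Esakia space $X$, $\mathbf{EsaEt}(X)$ is the slice over $X$ of the category of Esakia spaces and spectral local homeomorphisms: objects are spectral local homeomorphisms $Y\to X$ with $Y$ an Esakia space, and morphisms from $Y_1\to X$ to $Y_2\to X$ are spectral local homeomorphisms $Y_1\to Y_2$ commuting with the maps to $X$. Its terminal object is $\mathrm{id}_X$. *)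

(* Defs.v *)
From HB Require Import structures.
From mathcomp Require Import all_boot all_order.
From mathcomp Require Import all_classical.
From mathcomp Require Import topology.

Set Implicit Arguments.
Unset Strict Implicit.
Unset Printing Implicit Defensive.

Import Order.TTheory.

Local Open Scope classical_set_scope.

Lemma sval_injective (T : Type) (P : T -> Prop) : injective (@sval T P).
Proof.
case=> f pf [g pg] /= e; case: _ / e in pg *.
by congr exist; exact: Prop_irrelevance.
Qed.

Record category := Category {
  obj :> Type;
  hom : obj -> obj -> Type;
  idm : forall A, hom A A;
  mcomp : forall A B C, hom B C -> hom A B -> hom A C;
  mcomp1m : forall A B (f : hom A B), mcomp (idm B) f = f;
  mcompm1 : forall A B (f : hom A B), mcomp f (idm A) = f;
  mcompA : forall A B C D (h : hom C D) (g : hom B C) (f : hom A B),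
    mcomp h (mcomp g f) = mcomp (mcomp h g) f
}.

Arguments idm {_} A.
Arguments mcomp {_ A B C} g f.

Definition monomorphism (C : category) (A B : C) (f : hom A B) : Prop :=
  forall (Z : C) (g h : hom Z A), mcomp f g = mcomp f h -> g = h.

Definition jointly_epimorphic (C : category) (Y : C) (I : Type) (V : I -> C)
    (v : forall i, hom (V i) Y) : Prop :=
  forall (Z : C) (g h : hom Y Z),
    (forall i, mcomp g (v i) = mcomp h (v i)) -> g = h.

Record terminal_object (C : category) := TerminalObject {
  one :> C;
  bang : forall Y : C, hom Y one;
  bang_unique : forall (Y : C) (f : hom Y one), f = bang Y
}.

Definition subterminal (C : category) (T : terminal_object C) (V : C) : Prop :=
  monomorphism (bang T V).

Definition finitely_propositional (C : category) (T : terminal_object C) :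
    Prop :=
  forall Y : C, exists (I : finType) (V : I -> C) (v : forall i, hom (V i) Y),
    (forall i, subterminal T (V i)) /\ jointly_epimorphic v.

Section Slice.
Variables (C : category) (X : C).

Record slice_obj := SliceObj { slice_dom : C; slice_map : hom slice_dom X }.

Definition slice_hom (A B : slice_obj) : Type :=
  {h : hom (slice_dom A) (slice_dom B) |
    mcomp (slice_map B) h = slice_map A}.

Lemma slice_hom_eq (A B : slice_obj) (f g : slice_hom A B) :
  sval f = sval g -> f = g.
Proof. exact: sval_injective. Qed.

Definition slice_id (A : slice_obj) : slice_hom A A :=
  exist _ (idm (slice_dom A)) (mcompm1 (slice_map A)).

Lemma slice_comp_subproof (A B D : slice_obj) (g : slice_hom B D)
    (f : slice_hom A B) :
  mcomp (slice_map D) (mcomp (sval g) (sval f)) = slice_map A.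
Proof. by rewrite mcompA (svalP g) (svalP f). Qed.

Definition slice_comp (A B D : slice_obj) (g : slice_hom B D)
    (f : slice_hom A B) : slice_hom A D :=
  exist _ (mcomp (sval g) (sval f)) (slice_comp_subproof g f).

Lemma slice_comp1m (A B : slice_obj) (f : slice_hom A B) :
  slice_comp (slice_id B) f = f.
Proof. by apply: slice_hom_eq; exact: mcomp1m. Qed.

Lemma slice_compm1 (A B : slice_obj) (f : slice_hom A B) :
  slice_comp f (slice_id A) = f.
Proof. by apply: slice_hom_eq; exact: mcompm1. Qed.

Lemma slice_compA (A B D E : slice_obj) (h : slice_hom D E)
    (g : slice_hom B D) (f : slice_hom A B) :
  slice_comp h (slice_comp g f) = slice_comp (slice_comp h g) f.
Proof. by apply: slice_hom_eq; exact: mcompA. Qed.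

Definition slice : category :=
  Category slice_comp1m slice_compm1 slice_compA.

Definition slice_bang (A : slice) : hom A (SliceObj (idm X) : slice) :=
  exist _ (slice_map A) (mcomp1m (slice_map A)).

Lemma slice_bang_unique (A : slice)
    (f : hom A (SliceObj (idm X) : slice)) : f = slice_bang A.
Proof.
by apply: slice_hom_eq; rewrite -[LHS]mcomp1m; exact: (svalP f).
Qed.

Definition slice_terminal : terminal_object slice :=
  TerminalObject slice_bang_unique.

End Slice.

Definition upset d (T : porderType d) (U : set T) : Prop :=
  forall x y, U x -> (x <= y)%O -> U y.

Definition down_closure d (T : porderType d) (S : set T) : set T :=
  [set x | exists2 y, S y & (x <= y)%O].

HB.mixin Record isPriestley d T & POrderedTopological d T := {
  priestley_compact : compact [set: T];
  priestley_separation : forall x y : T, ~~ (x <= y)%O ->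
    exists U : set T, [/\ clopen U, upset U, U x & ~ U y]
}.

#[short(type="priestleyType")]
HB.structure Definition Priestley d :=
  { T of POrderedTopological d T & isPriestley d T }.

HB.mixin Record isEsakia d T & Priestley d T := {
  esakia_down_closure : forall W : set T, clopen W -> clopen (down_closure W)
}.

#[short(type="esakiaType")]
HB.structure Definition Esakia d := { T of Priestley d T & isEsakia d T }.

(* A copy of X carrying the spectral topology instead of the original one. *)
Definition spectral d (X : priestleyType d) : Type := X.

Section SpectralTopology.
Context d (X : priestleyType d).

Definition open_upset (U : set X) : Prop := open U /\ upset U.

Lemma open_upsetT : open_upset setT.
Proof. by split=> //; exact: openT. Qed.

Lemma open_upsetI : setI_closed open_upset.
Proof.
move=> A B [oA uA] [oB uB]; split; first exact: openI.
by move=> x y [Ax Bx] xy; split; [exact: uA xy|exact: uB xy].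
Qed.

Lemma open_upset_bigcup (I : Type) (f : I -> set X) :
  (forall i, open_upset (f i)) -> open_upset (\bigcup_i f i).
Proof.
move=> fo; split; first by apply: bigcup_open => i _; case: (fo i).
by move=> x y [i _ fix_] xy; exists i => //; exact: (fo i).2 _ _ fix_ xy.
Qed.

HB.instance Definition _ := Choice.copy (spectral X) X.
HB.instance Definition _ := isOpenTopological.Build (spectral X)
  open_upsetT open_upsetI open_upset_bigcup.

Lemma spectral_openE : (open : set (set (spectral X))) = open_upset.
Proof. by []. Qed.

End SpectralTopology.

(* The second clause says that f restricts to a homeomorphism from U onto
   f @` U, with inverse g. *)
Definition local_homeomorphism (S T : topologicalType) (f : S -> T) : Prop :=
  forall x : S, exists U : set S, [/\ open U, U x, open (f @` U) &
    exists g : T -> S, [/\ {in U, cancel f g}, {within U, continuous f} &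
      {within f @` U, continuous g}]].

Definition spectral_local_homeomorphism d d' (Y : priestleyType d)
    (X : priestleyType d') (f : Y -> X) : Prop :=
  local_homeomorphism (f : spectral Y -> spectral X).

Section LocalHomeomorphismTheory.

Lemma within_open_continuousP (S T : topologicalType) (U : set S) (f : S -> T) :
  open U ->
  ({within U, continuous f} <-> forall W, open W -> open (U `&` f @^-1` W)).
Proof.
move=> oU; split => [/continuousP cf W oW|cf].
  by rewrite open_setSI//; exact: cf.
by apply/continuousP => W oW; rewrite -open_setSI//; exact: cf.
Qed.

Lemma local_homeomorphism_id (T : topologicalType) :
  local_homeomorphism (@id T).
Proof.
move=> x; exists setT; split=> //; rewrite ?image_id; try exact: openT.
exists id; split=> //; rewrite ?image_id;
  by apply: continuous_subspaceT => y; exact: cvg_id.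
Qed.

Lemma local_homeomorphism_comp (R S T : topologicalType) (f : S -> T)
    (h : R -> S) :
  local_homeomorphism f -> local_homeomorphism h ->
  local_homeomorphism (f \o h).
Proof.
move=> lf lh x.
have [U [oU Ux ohU [k [hk ch ck]]]] := lh x.
have [V [oV Vhx ofV [g [fg cf cg]]]] := lf (h x).
have {ch}ch := (within_open_continuousP h oU).1 ch.
have {ck}ck := (within_open_continuousP k ohU).1 ck.
have {cf}cf := (within_open_continuousP f oV).1 cf.
have {cg}cg := (within_open_continuousP g ofV).1 cg.
have imV A : open A -> open (f @` (A `&` V)).
  move=> oA; suff -> : f @` (A `&` V) = f @` V `&` g @^-1` A by exact: cg.
  apply/seteqP; split=> [_ [y [Ay Vy] <-]|_ [[y Vy <-]]].
    by split; [exists y|rewrite /preimage /= fg ?inE].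
  by rewrite /preimage /= fg ?inE// => Ay; exists y.
have imE A : (f \o h) @` (U `&` h @^-1` V `&` A) =
    f @` (h @` U `&` k @^-1` A `&` V).
  apply/seteqP; split=> [_ [y [[Uy Vy] Ay] <-]|_ [_ [[[y Uy <-] Ay] Vy] <-]].
    exists (h y) => //; split=> //; split; first by exists y.
    by rewrite /preimage /= hk ?inE.
  by exists y => //; split=> //; move: Ay; rewrite /preimage /= hk ?inE.
have oW : open (U `&` h @^-1` V) by exact: ch.
have oimW : open ((f \o h) @` (U `&` h @^-1` V)).
  rewrite -[X in _ @` X]setIT imE preimage_setT setIT.
  exact: imV.
exists (U `&` h @^-1` V); split=> //; exists (k \o g); split.
- move=> y; rewrite inE => -[Uy Vy] /=.
  by rewrite fg ?inE// hk ?inE.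
- apply/within_open_continuousP => // A oA.
  have -> : U `&` h @^-1` V `&` (f \o h) @^-1` A =
    U `&` h @^-1` (V `&` f @^-1` A) by rewrite preimage_setI setIA.
  by apply: ch; exact: cf.
- apply/within_open_continuousP => // A oA.
  suff -> : (f \o h) @` (U `&` h @^-1` V) `&` (k \o g) @^-1` A =
      (f \o h) @` (U `&` h @^-1` V `&` A).
    by rewrite imE; apply: imV; exact: ck.
  apply/seteqP; split=> [_ [[y [Uy Vy] <-]]|_ [y [[Uy Vy] Ay] <-]].
    by rewrite /preimage /= fg ?inE// hk ?inE// => Ay; exists y.
  by split; [exists y|rewrite /preimage /= fg ?inE// hk ?inE].
Qed.

End LocalHomeomorphismTheory.

Section EsakiaCategory.
Context (d : Order.disp_t).

Definition esakia_hom (Y X : esakiaType d) : Type :=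
  {f : Y -> X | spectral_local_homeomorphism f}.

Definition esakia_id (X : esakiaType d) : esakia_hom X X :=
  exist _ id (@local_homeomorphism_id (spectral X)).

Definition esakia_comp (Z Y X : esakiaType d) (g : esakia_hom Y X)
    (f : esakia_hom Z Y) : esakia_hom Z X :=
  exist _ (sval g \o sval f) (local_homeomorphism_comp (svalP g) (svalP f)).

Lemma esakia_hom_eq (Y X : esakiaType d) (f g : esakia_hom Y X) :
  sval f = sval g -> f = g.
Proof. exact: sval_injective. Qed.

Lemma esakia_comp1m (Y X : esakiaType d) (f : esakia_hom Y X) :
  esakia_comp (esakia_id X) f = f.
Proof. exact: esakia_hom_eq. Qed.

Lemma esakia_compm1 (Y X : esakiaType d) (f : esakia_hom Y X) :
  esakia_comp f (esakia_id Y) = f.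
Proof. exact: esakia_hom_eq. Qed.

Lemma esakia_compA (W Z Y X : esakiaType d) (h : esakia_hom Y X)
    (g : esakia_hom Z Y) (f : esakia_hom W Z) :
  esakia_comp h (esakia_comp g f) = esakia_comp (esakia_comp h g) f.
Proof. exact: esakia_hom_eq. Qed.

Definition EsaLH : category :=
  Category esakia_comp1m esakia_compm1 esakia_compA.

Definition EsaEt (X : esakiaType d) : category := @slice EsaLH X.

Definition EsaEt_terminal (X : esakiaType d) : terminal_object (EsaEt X) :=
  @slice_terminal EsaLH X.

End EsakiaCategory.

(* Main.v *)
Require Import Defs.
From HB Require Import structures.
From mathcomp Require Import all_boot all_order.
From mathcomp Require Import all_classical.
From mathcomp Require Import topology.

(** Let [f : Y -> X] be a spectral local homeomorphism of Esakia spaces.  Every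
    point of [Y] lies in an open upset on which [f] is injective.  In a
    Priestley space the clopen upsets form a basis of the spectral topology
    ([clopen_upset_nbhs]), so these neighbourhoods may be taken to be clopen
    upsets, and by compactness finitely many of them cover [Y]
    ([finite_clopen_upset_cover]).

    A clopen subspace of an Esakia space is again an Esakia space, and if it is
    moreover an upset, then its inclusion is a spectral local homeomorphism
    ([clopen_subspace_val_local_homeomorphism]).  The members of the cover are
    therefore objects over [X].  They are subterminal because their structure
    maps, being restrictions of [f], are injective; and their inclusions are
    jointly epimorphic because they are jointly surjective. *)

Set Implicit Arguments.
Unset Strict Implicit.
Unset Printing Implicit Defensive.

Import Order.TTheory.

Local Open Scope classical_set_scope.

(** Compactness as an induction principle: an ideal of subsets that contains a
    neighbourhood of each point of a compact set contains the compact set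
    itself.  No base point of the ambient space is needed. *)
Lemma compact_ideal_ind (T : topologicalType) (K : set T)
    (P : set T -> Prop) :
  compact K -> P set0 -> (forall A B, A `<=` B -> P B -> P A) ->
  (forall A B, P A -> P B -> P (A `|` B)) ->
  (forall x, K x -> exists2 U, nbhs x U & P U) -> P K.
Proof.
move=> cK P0 PS PU Ploc; apply: contrapT => nPK.
(* A cluster point of this filter cannot have a neighbourhood in the ideal. *)
pose F : set_system T := [set A | P (K `\` A)].
have FF : Filter F.
  split.
  - by rewrite /F /= setDT.
  - by move=> A B; rewrite /F /= setDIr; exact: PU.
  - by move=> A B AB; apply: PS; exact: setDS.
have PF : ProperFilter F by split; rewrite /F //= setD0.
have FK : F K by rewrite /F /= setDv.
have [x [Kx clx]] := cK F PF FK.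
have [U nU idU] := Ploc x Kx.
have FU : F (~` U).
  by rewrite /F /= setDE setCK; apply: PS idU; exact: subIsetr.
by have [y []] := clx _ _ FU nU.
Qed.

Lemma compact_set_type (T : topologicalType) (A : set T) :
  compact A -> compact [set: A].
Proof.
move=> cA F PF _.
have [x [Ax clx]] : A `&` cluster (set_val @ F) !=set0.
  apply: cA; rewrite /nbhs /=; apply: filterS (@filterT _ F _) => x _.
  exact: set_valP.
exists (SigSub (mem_set Ax)); split=> // B C FB [_ [[D oD <-] /= Dx] DC].
have Fim : (set_val @ F) (set_val @` B).
  by rewrite /nbhs /=; apply: filterS FB => z Bz; exists z.
have [_ [[z Bz <-] Dz]] := clx _ _ Fim (open_nbhs_nbhs (conj oD Dx)).
by exists z; split=> //; exact: DC.
Qed.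

(** A clopen subset of a space as a space of its own, with the subspace
    topology and the induced order.  The unused proof of clopenness lets the
    Priestley and Esakia structures be inferred from the type alone. *)
Definition clopen_subspace (T : topologicalType) (W : set T) (_ : clopen W) :
  Type := set_type W.

Section ClopenSubspaceTopology.
Context (T : topologicalType) (W : set T) (cW : clopen W).

HB.instance Definition _ := SubType.on (clopen_subspace cW).
HB.instance Definition _ := Topological.on (clopen_subspace cW).

Lemma clopen_subspace_val_continuous :
  continuous (val : clopen_subspace cW -> T).
Proof. exact: initial_continuous. Qed.

Lemma clopen_subspace_image_open (A : set (clopen_subspace cW)) :
  open A -> open (val @` A).
Proof.
move=> [B oB <-].
suff -> : (val : clopen_subspace cW -> T) @` (val @^-1` B) = B `&` W.
  by apply: openI => //; exact: cW.1.
apply/seteqP; split=> [_ [x Bx <-]|x [Bx Wx]].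
  by split=> //; exact: set_valP.
by exists (SigSub (mem_set Wx)).
Qed.

Lemma clopen_subspace_image_clopen (A : set (clopen_subspace cW)) :
  clopen A -> clopen (val @` A).
Proof.
move=> [oA cA]; split; first exact: clopen_subspace_image_open.
rewrite -openC; suff -> : ~` (val @` A) = ~` W `|` val @` (~` A).
  apply: openU; first by rewrite openC; exact: cW.2.
  by apply: clopen_subspace_image_open; rewrite openC.
apply/seteqP; split=> [x nAx|x [nWx [y _ xy]|[y nAy <-] [z Az /val_inj zy]]].
- case: (pselect (W x)) => [Wx|]; last by left.
  by right; exists (SigSub (mem_set Wx)) => // Ax; apply: nAx; eexists;
    first exact: Ax.
- by apply: nWx; rewrite -xy; exact: set_valP.
- by apply: nAy; rewrite -zy.
Qed.

End ClopenSubspaceTopology.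

Section ClopenSubspacePriestley.
Context d (Y : priestleyType d) (W : set Y) (cW : clopen W).

HB.instance Definition _ :=
  [SubChoice_isSubPOrder of clopen_subspace cW by <: with d].

Lemma clopen_subspace_compact : compact [set: clopen_subspace cW].
Proof.
apply: compact_set_type; apply: subclosed_compact (@subsetT _ W).
  exact: cW.2.
exact: priestley_compact.
Qed.

Lemma clopen_subspace_separation (x y : clopen_subspace cW) : ~~ (x <= y)%O ->
  exists U, [/\ clopen U, upset U, U x & ~ U y].
Proof.
rewrite -Order.le_val => /priestley_separation [U [cU uU Ux nUy]].
exists (val @^-1` U); split=> //.
  by apply: preimage_clopen => //; exact: clopen_subspace_val_continuous.
by move=> a b Ua ab; apply: (uU (val a)) Ua _; rewrite Order.le_val.
Qed.

HB.instance Definition _ := isPriestley.Build d (clopen_subspace cW)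
  clopen_subspace_compact clopen_subspace_separation.

(** The inclusion of a clopen upset is open for the spectral topologies, and
    its inverse extends to the ambient space by a constant. *)
Lemma clopen_subspace_val_local_homeomorphism :
  upset W ->
  spectral_local_homeomorphism (val : clopen_subspace cW -> Y).
Proof.
move=> uW x.
have imU (A : set (clopen_subspace cW)) :
    open_upset A -> open_upset (val @` A).
  move=> [oA uA]; split; first exact: clopen_subspace_image_open.
  move=> _ y [a Aa <-] ay.
  have Wy : W y by apply: uW ay; exact: set_valP.
  exists (SigSub (mem_set Wy)) => //.
  by apply: uA Aa _; rewrite -Order.le_val.
have oT := openT (T := spectral (clopen_subspace cW)).
have oim : open ((val : _ -> spectral Y) @`
    [set: spectral (clopen_subspace cW)]).
  exact: imU.
exists setT; split=> //; exists (insubd x); split.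
- by move=> a _; exact: valKd.
- apply/within_open_continuousP => // A [oA uA]; rewrite setTI; split.
    by have /continuousP := @clopen_subspace_val_continuous _ _ cW; exact.
  by move=> a b Aa ab; apply: (uA (val a)) Aa _; rewrite Order.le_val.
- apply/within_open_continuousP => // A oA.
  suff -> : (val : spectral (clopen_subspace cW) -> spectral Y) @` setT `&`
      insubd x @^-1` A = val @` A by exact: imU.
  apply/seteqP; split=> [_ [[a _ <-]]|_ [a Aa <-]].
    by rewrite /preimage /= valKd => Aa; exists a.
  by split; [exists a|rewrite /preimage /= valKd].
Qed.

End ClopenSubspacePriestley.

Section ClopenSubspaceEsakia.
Context d (Y : esakiaType d) (W : set Y) (cW : clopen W).

(** The down-closure in [W] is the trace on [W] of the down-closure in [Y]. *)
Lemma clopen_subspace_down_closure (A : set (clopen_subspace cW)) :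
  clopen A -> clopen (down_closure A).
Proof.
move=> cA; suff -> : down_closure A = val @^-1` down_closure (val @` A).
  apply: preimage_clopen; last exact: clopen_subspace_val_continuous.
  by apply: esakia_down_closure; exact: clopen_subspace_image_clopen.
apply/seteqP; split=> [x [y Ay xy]|x [_ [y Ay <-] xy]].
  by exists (val y); [exists y|rewrite Order.le_val].
by exists y => //; rewrite -Order.le_val.
Qed.

HB.instance Definition _ := isEsakia.Build d (clopen_subspace cW)
  clopen_subspace_down_closure.

End ClopenSubspaceEsakia.

(** The clopen upsets form a basis of the spectral topology. *)
Lemma clopen_upset_nbhs d (Y : priestleyType d) (U : set Y) (x : Y) :
  open_upset U -> U x ->
  exists V : set Y, [/\ clopen V, upset V, V x & V `<=` U].
Proof.
move=> [oU uU] Ux.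
(* The ideal of the sets disjoint from some clopen upset containing x. *)
pose P (A : set Y) :=
  exists V : set Y, [/\ clopen V, upset V, V x & V `<=` ~` A].
suff : P (~` U) by rewrite /P setCK.
apply: compact_ideal_ind.
- apply: subclosed_compact (@subsetT _ _); first exact: open_closedC.
  exact: priestley_compact.
- by exists setT; split=> //; [exact: clopenT|rewrite setC0].
- by move=> A B AB [V [cV uV Vx VB]]; exists V; split=> // y /VB nBy /AB.
- move=> A B [V [cV uV Vx VA]] [V' [cV' uV' V'x V'B]].
  exists (V `&` V'); split=> //; first exact: clopenI.
    by move=> y z [Vy V'y] yz; split; [exact: uV yz|exact: uV' yz].
  by rewrite setCU; exact: setISS.
- move=> y nUy; have /priestley_separation [V [cV uV Vx nVy]] : ~~ (x <= y)%O.
    by apply/negP => xy; apply: nUy; exact: uU xy.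
  exists (~` V); last by exists V; split=> //; rewrite setCK.
  by apply: open_nbhs_nbhs; split=> //; rewrite openC; exact: cV.2.
Qed.

(** The domain of a spectral local homeomorphism is covered by finitely many
    clopen upsets on which it is injective. *)
Lemma finite_clopen_upset_cover d d' (Y : priestleyType d)
    (X : priestleyType d') (f : Y -> X) :
  spectral_local_homeomorphism f ->
  exists (n : nat) (W : 'I_n -> set Y),
    [/\ forall i, clopen (W i), forall i, upset (W i),
        forall i x y, W i x -> W i y -> f x = f y -> x = y &
        forall x, exists i, W i x].
Proof.
move=> lf.
pose P (A : set Y) := exists (n : nat) (W : 'I_n -> set Y),
  [/\ forall i, clopen (W i), forall i, upset (W i),
      forall i x y, W i x -> W i y -> f x = f y -> x = y &
      forall x, A x -> exists i, W i x].
suff [n [W [cW uW iW Wcov]]] : P setT.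
  by exists n, W; split=> // x; exact: Wcov.
apply: compact_ideal_ind.
- exact: priestley_compact.
- by exists 0, (fun=> set0); split=> // -[].
- move=> A B AB [n [W [cW uW iW Wcov]]].
  by exists n, W; split=> // x /AB; exact: Wcov.
- move=> A B [n [W [cW uW iW Wcov]]] [m [V [cV uV iV Vcov]]].
  pose WV (i : 'I_(n + m)) :=
    match fintype.split i with inl j => W j | inr k => V k end.
  exists (n + m)%N, WV; split.
  + by move=> i; rewrite /WV; case: (fintype.split i).
  + by move=> i; rewrite /WV; case: (fintype.split i).
  + by move=> i; rewrite /WV; case: (fintype.split i).
  + move=> x [/Wcov [i Wx]|/Vcov [i Vx]].
      by exists (unsplit (inl i)); rewrite /WV unsplitK.
    by exists (unsplit (inr i)); rewrite /WV unsplitK.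
- move=> y _; have [U [oU Uy _ [g [fK _ _]]]] := lf y.
  have [V [cV uV Vy VU]] := clopen_upset_nbhs oU Uy.
  exists V; first by apply: open_nbhs_nbhs; split=> //; exact: cV.1.
  exists 1, (fun=> V); split=> //; last by move=> x Vx; exists ord0.
  move=> _ a b /VU Ua /VU Ub fab.
  by rewrite -(fK a (mem_set Ua)) -(fK b (mem_set Ub)) fab.
Qed.

Section EsakiaEtale.
Context (d : Order.disp_t) (X : esakiaType d).

(** The map underlying a morphism over [X]. *)
Definition etale_fun (A B : EsaEt X) (h : hom A B) :
  (slice_dom A : esakiaType d) -> (slice_dom B : esakiaType d) :=
  sval (sval h).

Lemma etale_fun_inj (A B : EsaEt X) (g h : hom A B) :
  etale_fun g =1 etale_fun h -> g = h.
Proof. by move=> gh; apply/slice_hom_eq/esakia_hom_eq/funext. Qed.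

Lemma injective_subterminal (A : EsaEt X) :
  injective (sval (slice_map A)) -> subterminal (EsaEt_terminal X) A.
Proof.
move=> injA Z g h gh; apply: etale_fun_inj => z; apply: injA.
exact: (congr1 (fun k => etale_fun k z) gh).
Qed.

Lemma surjective_jointly_epimorphic (Y : EsaEt X) (I : Type) (V : I -> EsaEt X)
    (v : forall i, hom (V i) Y) :
  (forall y, exists i x, etale_fun (v i) x = y) -> jointly_epimorphic v.
Proof.
move=> surj Z g h gh; apply: etale_fun_inj => y.
have [i [x <-]] := surj y.
exact: (congr1 (fun k => etale_fun k x) (gh i)).
Qed.

End EsakiaEtale.

Theorem theorem6p2 (d : Order.disp_t) (X : esakiaType d) :
  finitely_propositional (EsaEt_terminal X).
Proof.
move=> Y; pose D : esakiaType d := slice_dom Y.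
pose f : esakia_hom D X := slice_map Y.
have [n [W [cW uW iW Wcov]]] := finite_clopen_upset_cover (svalP f).
pose S i : esakiaType d := clopen_subspace (cW i).
pose v i : esakia_hom (S i) D :=
  exist _ val (clopen_subspace_val_local_homeomorphism (uW i)).
pose V i : EsaEt X := @SliceObj (EsaLH d) X (S i) (esakia_comp f (v i)).
exists 'I_n, V, (fun i => exist _ (v i) erefl : hom (V i) Y); split.
  move=> i; apply: injective_subterminal => a b fab; apply: val_inj.
  by apply: iW fab; exact: set_valP.
apply: surjective_jointly_epimorphic => y; have [i Wy] := Wcov y.
by exists i, (SigSub (mem_set Wy)).
Qed.
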